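(* Let $n,d_1,\dots,d_n$ be positive integers and let $P=\{1,\dots,d_1\}\times\cdots\times\{1,\dots,d_n\}$ be equipped with the product order. For arbitrary $C_i\in\mathbb{C}^{d_i\times d_i}$, $i=1,\dots,n$, we have $$C_1\otimes\cdots\otimes C_n\in\overline{\mathcal{L}(P)\,\mathcal{U}(P)}.$$
   Context: The product order on $P$ is $(x_1,\dots,x_n)\le(y_1,\dots,y_n)$ iff $x_i\le y_i$ for all $i$, with the usual order on each $\{1,\dots,d_i\}$. The tensor product $C_1\otimes\cdots\otimes C_n$ is regarded as the matrix in $\mathbb{C}^{P\times P}$ with entries $(C_1\otimes\cdots\otimes C_n)_{x,y}=\prod_{i=1}^n(C_i)_{x_i,y_i}$. For a finite poset $P$, $$\mathcal{L}(P):=\{L\in\mathbb{C}^{P\times P}\mid L_{xy}=0\text{ unless }y\le x\},\qquad \mathcal{U}(P):=\{U\in\mathbb{C}^{P\times P}\mid U_{xy}=0\text{ unless }x\le y\},$$ $\mathcal{L}(P)\,\mathcal{U}(P)=\{LU\mid L\in\mathcal{L}(P),U\in\mathcal{U}(P)\}$, and the bar denotes the closure in the norm topology. *)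

(* Defs.v *)
From HB Require Import structures.
From mathcomp Require Import all_boot all_order all_algebra complex.
From mathcomp Require Import all_classical all_reals topology normedtype.

Set Implicit Arguments.
Unset Strict Implicit.
Unset Printing Implicit Defensive.

Import Order.TTheory GRing.Theory Num.Theory.
Import numFieldNormedType.Exports.

Local Open Scope classical_set_scope.
Local Open Scope ring_scope.
Local Open Scope complex_scope.

(* The libraries put no topology on R[i]; this is the one of the modulus. The
   topology of 'M[R[i]]_n is then that of the (max-entry) matrix norm. *)
HB.instance Definition _ (R : realType) := NormedModule.copy R[i] R[i]^o.

(* The factor {1, ..., d i} is represented by {0, ..., d i - 1}. *)
Definition box (n : nat) (d : 'I_n -> nat) : predArgType :=
  {dffun forall i : 'I_n, 'I_(d i)}.

HB.instance Definition _ (n : nat) (d : 'I_n -> nat) :=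
  Finite.copy (box d) {dffun forall i : 'I_n, 'I_(d i)}.

Definition box_le (n : nat) (d : 'I_n -> nat) (x y : box d) : bool :=
  [forall i, (x i <= y i)%N].

Fact box_display : Order.disp_t. Proof. exact: Order.Disp tt tt. Qed.

Section BoxOrder.
Variables (n : nat) (d : 'I_n -> nat).

Fact box_le_refl : reflexive (@box_le n d).
Proof. by move=> x; apply/forallP. Qed.

Fact box_le_anti : antisymmetric (@box_le n d).
Proof.
move=> x y /andP[/forallP le_xy /forallP le_yx]; apply/ffunP => i.
by apply/val_inj/eqP; rewrite eqn_leq le_xy le_yx.
Qed.

Fact box_le_trans : transitive (@box_le n d).
Proof.
move=> y x z /forallP le_xy /forallP le_yz; apply/forallP => i.
exact: leq_trans (le_xy i) (le_yz i).
Qed.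

HB.instance Definition _ := Order.Le_isPOrder.Build box_display (box d)
  box_le_refl box_le_anti box_le_trans.

End BoxOrder.

(* A matrix indexed by a finite type P is an element of 'M_#|P|, its (x, y)
   entry sitting at position (enum_rank x, enum_rank y). *)
Definition lower_mx (K : nmodType) (disp : Order.disp_t)
    (P : finPOrderType disp) : set 'M[K]_#|P| :=
  [set L | forall x y : P, ~~ (y <= x)%O -> L (enum_rank x) (enum_rank y) = 0].

Definition upper_mx (K : nmodType) (disp : Order.disp_t)
    (P : finPOrderType disp) : set 'M[K]_#|P| :=
  [set U | forall x y : P, ~~ (x <= y)%O -> U (enum_rank x) (enum_rank y) = 0].

Arguments lower_mx K {disp} P.
Arguments upper_mx K {disp} P.

Definition LU_mx (K : pzSemiRingType) (disp : Order.disp_t)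
    (P : finPOrderType disp) : set 'M[K]_#|P| :=
  [set L *m U | L in lower_mx K P & U in upper_mx K P].

Arguments LU_mx K {disp} P.

Definition tensor_mx (K : pzSemiRingType) (n : nat) (d : 'I_n -> nat)
    (C : forall i : 'I_n, 'M[K]_(d i)) : 'M[K]_#|box d| :=
  \matrix_(a, b)
    \prod_(i < n) C i ((enum_val a : box d) i) ((enum_val b : box d) i).

(* Main.v *)
Require Import Defs.
From mathcomp Require Import all_boot all_order all_algebra complex.
From mathcomp Require Import all_classical all_reals topology normedtype.

(** The shifted matrices [C i + t%:M] converge to [C i] as [t] tends to [0]. For
    all small [t != 0] the leading principal minors of [C i + t%:M] do not vanish,
    being values of characteristic polynomials, so [C i + t%:M] is a product
    [L i *m U i] of a lower and an upper triangular matrix. The tensor product is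
    multiplicative and continuous, and it maps families of lower (upper)
    triangular matrices to matrices in [lower_mx] ([upper_mx]). *)

Import Order.TTheory GRing.Theory Num.Theory.
Import numFieldNormedType.Exports.

Local Open Scope classical_set_scope.
Local Open Scope ring_scope.
Local Open Scope complex_scope.

(** Picking one summand in each factor is picking a dependent function. The types [T_ i] are
    embedded in their tagged sum, where distributivity for ordinary functions applies. *)
Lemma prod_sum_dffun (K : comPzSemiRingType) (I : finType) (T_ : I -> finType)
    (F : forall i, T_ i -> K) :
  \prod_i \sum_(j : T_ i) F i j =
  \sum_(f : {dffun forall i, T_ i}) \prod_i F i (f i).
Proof.
rewrite (reindex (@dffun_of_fprod I T_)) /=; last first.
  exact/onW_bij/dffun_of_fprod_bij.
transitivity (\prod_i \sum_(j : T_ i) [ffun j => F i j] j).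
  by do 2![apply: eq_bigr => ? _]; rewrite ffunE.
under eq_bigr do rewrite (big_tag (fun i => [ffun j => F i j])).
rewrite bigA_distr_big_dep -(big_fprod 1 +%R (fun i => [ffun j => F i j])).
by do 2![apply: eq_bigr => ? _]; rewrite !ffunE.
Qed.

Section Tensor.
Variables (K : comPzSemiRingType) (n : nat) (d : 'I_n -> nat).
Implicit Types A B : forall i : 'I_n, 'M[K]_(d i).

(** Each entry on the right is a product of sums; expanding it gives one term per intermediate index
    in the box. *)
Lemma tensor_mxM A B :
  tensor_mx A *m tensor_mx B = tensor_mx (fun i => A i *m B i).
Proof.
apply/matrixP => a b; rewrite !mxE.
under [RHS]eq_bigr do rewrite mxE.
rewrite prod_sum_dffun (reindex_onto enum_rank enum_val) /=; last first.
  by move=> i _; exact: enum_valK.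
apply: eq_big => [x|x _]; first by rewrite enum_rankK eqxx.
by rewrite !mxE -big_split /= enum_rankK.
Qed.

Lemma tensor_mx_lower A :
  (forall i, is_trig_mx (A i)) -> lower_mx K (box d) (tensor_mx A).
Proof.
move=> trigA x y; rewrite negb_forall => /existsP[k]; rewrite -ltnNge => lt_xy.
rewrite mxE !enum_rankK (bigD1 k) //= (is_trig_mxP (trigA k)) ?mul0r //.
Qed.

Lemma tensor_mx_upper A :
  (forall i, is_trig_mx (A i)^T) -> upper_mx K (box d) (tensor_mx A).
Proof.
move=> trigA x y; rewrite negb_forall => /existsP[k]; rewrite -ltnNge => lt_yx.
rewrite mxE !enum_rankK (bigD1 k) //=.
by have /is_trig_mxP/(_ _ _ lt_yx) := trigA k; rewrite mxE => ->; rewrite mul0r.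
Qed.

End Tensor.

Section Shift.
Variable K : numFieldType.

Lemma near0_neq (a : K) : \forall t \near 0^', t != a.
Proof.
have [->|a0] := eqVneq a 0; first exact: nbhs_dnbhs_neq.
apply: nbhs_dnbhs; near do rewrite -subr_eq0.
apply: (@cvgr_neq0 _ _ _ _ _ _ (0 - a)); last by rewrite sub0r oppr_eq0.
by apply: cvgB; [exact: cvg_id | exact: cvg_cst].
Unshelve. all: by end_near. Qed.

(** Induction on the size: if [a] is a root, dividing by ['X - a%:P] leaves a smaller polynomial,
    and [t] only has to avoid [a] as well. *)
Lemma near0_nonroot (p : {poly K}) :
  p != 0 -> \forall t \near (0 : K)^', ~~ root p t.
Proof.
have [m] := ubnP (size p); elim: m p => // m IHm p lepm p0.
have [[a pa0]|] := pselect (exists a, root p a); last first.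
  by move=> noroot; near=> t; apply/negP => pt0; apply: noroot; exists t.
have [q pE] := factor_theorem _ _ pa0.
have q0 : q != 0 by apply: contraNneq p0 => q0; rewrite pE q0 mul0r.
have leqm : (size q < m)%N.
  by move: lepm; rewrite pE size_Mmonic ?monicXsubC // size_XsubC addn2.
near=> t; rewrite pE rootM root_XsubC negb_or; apply/andP; split.
  by near: t; exact: IHm.
by near: t; exact: near0_neq.
Unshelve. all: by end_near. Qed.

(** [A + t%:M] is singular only if [t] is an eigenvalue of [- A], hence a root of a monic
    polynomial. *)
Lemma near0_shift_unit m (A : 'M[K]_m) :
  \forall t \near (0 : K)^', A + t%:M \in unitmx.
Proof.
have p0 : char_poly (- A) != 0 by rewrite monic_neq0 ?char_poly_monic.
apply: filterS (near0_nonroot _ p0) => t; apply: contraNT.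
rewrite -row_free_unit -kermx_eq0 -eigenvalue_root_char /eigenvalue /eigenspace.
by rewrite -opprD !kermx_eq0 /row_free mxrank_opp.
Qed.

Lemma near0_shift_LU m (A : 'M[K]_m) : \forall t \near (0 : K)^',
  exists L U : 'M[K]_m, [/\ is_trig_mx L, is_trig_mx U^T & A + t%:M = L *m U].
Proof.
elim: m A => [|m IHm] A.
  near=> t; exists 0, 0; split; last by rewrite !thinmx0.
  - by apply/is_trig_mxP => -[].
  - by apply/is_trig_mxP => -[].
(* The size is written [m + 1] so that the blocks split off the last row and column. *)
move: A; rewrite -addn1 => A; rewrite -[A]submxK.
set A' := ulsubmx A; set b := ursubmx A; set c := dlsubmx A; set e := drsubmx A.
apply: filterS2 (IHm _) (near0_shift_unit _ A') => t [L [U [trL trU LU]]].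
rewrite LU unitmx_mul => /andP[uL uU].
(* The borders solve [L *m x = b] and [y *m U = c]; the last entry of the upper factor is the Schur
   complement of the leading block. *)
exists (block_mx L 0 (c *m invmx U) 1%:M).
exists (block_mx U (invmx L *m b) 0 (e + t%:M - c *m invmx U *m (invmx L *m b))).
split.
- by rewrite is_trig_block_mx // eqxx trL; apply/is_trig_mxP => i j; rewrite !ord1.
- rewrite tr_block_mx is_trig_block_mx // trmx0 eqxx trU.
  by apply/is_trig_mxP => i j; rewrite !ord1.
rewrite mulmx_block !mulmx0 !mul0mx !addr0 mul1mx mulmxKV // mulKVmx // -LU.
by rewrite scalar_mx_block add_block_mx !addr0 (addrC (c *m _ *m _)) subrK.
Unshelve. all: by end_near. Qed.

Lemma tensor_mx_shift_LU n (d : 'I_n -> nat) (C : forall i, 'M[K]_(d i)) :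
  \forall t \near (0 : K)^',
    LU_mx K (box d) (tensor_mx (fun i => C i + t%:M)).
Proof.
(* There are finitely many factors, so one [t] serves them all. *)
apply: filterS (filter_forall (Proper_dnbhs_numFieldType (0 : K))
  (fun k : 'I_n => near0_shift_LU _ (C k))) => t LUt.
pose L k := projT1 (cid (LUt k)); pose U k := projT1 (cid (projT2 (cid (LUt k)))).
have LU k : [/\ is_trig_mx (L k), is_trig_mx (U k)^T & C k + t%:M = L k *m U k].
  exact: projT2 (cid (projT2 (cid (LUt k)))).
exists (tensor_mx L); first by apply: tensor_mx_lower => i; have [] := LU i.
exists (tensor_mx U); first by apply: tensor_mx_upper => i; have [] := LU i.
rewrite tensor_mxM; apply/matrixP => a b; rewrite !mxE; apply: eq_bigr => i _.
by have [_ _ ->] := LU i.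
Qed.

Lemma shift_entry_cvg m (A : 'M[K]_m) (i j : 'I_m) :
  (A + t%:M) i j @[t --> (0 : K)] --> A i j.
Proof.
(* The limit takes the shape [A i j + 0 *+ (i == j)] of the entries of [A + t%:M]. *)
rewrite -[X in _ --> X]addr0 -[X in _ + X](mul0rn _ (i == j)).
under eq_fun do rewrite mxE mxE.
exact: (cvgD (cvg_cst _) (cvgMn cvg_id)).
Qed.

Lemma tensor_mx_shift_cvg n (d : 'I_n -> nat) (C : forall i, 'M[K]_(d i)) :
  tensor_mx (fun i => C i + t%:M) @[t --> (0 : K)] --> tensor_mx C.
Proof.
move=> B [P nbhsP sPB].
(* [B] contains a product of entry neighbourhoods [P a b], so convergence is checked on the finitely
   many entries. *)
have : \forall t \near (0 : K), forall ab : 'I_#|box d| * 'I_#|box d|,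
    P ab.1 ab.2 (tensor_mx (fun i => C i + t%:M) ab.1 ab.2).
  apply: (filter_forall (nbhs_filter (0 : K))) => -[a b] /=.
  suff : tensor_mx (fun i => C i + t%:M) a b @[t --> (0 : K)] --> tensor_mx C a b.
    by apply; exact: nbhsP.
  under eq_fun do rewrite mxE; rewrite mxE.
  apply: (cvg_big mul_continuous (nbhs_filter (0 : K))) => i _.
  exact: shift_entry_cvg.
by apply: filterS => t Pt; apply: sPB => a b; exact: Pt (a, b).
Qed.

Lemma closure_LU_tensor_mx n (d : 'I_n -> nat) (C : forall i, 'M[K]_(d i)) :
  closure (LU_mx K (box d)) (tensor_mx C).
Proof.
move=> B /tensor_mx_shift_cvg /nbhs_dnbhs nearB.
(* Punctured neighbourhoods of [0] are non-empty, so a suitable [t] exists. *)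
have [t [LUt Bt]] := filter_ex (filterI (tensor_mx_shift_LU _ _ C) nearB).
by exists (tensor_mx (fun i => C i + t%:M)).
Qed.

End Shift.

Theorem lemma4 (R : realType) (n : nat) (d : 'I_n -> nat)
    (n_gt0 : (0 < n)%N) (d_gt0 : forall i : 'I_n, (0 < d i)%N)
    (C : forall i : 'I_n, 'M[R[i]]_(d i)) :
  closure (LU_mx R[i] (box d)) (tensor_mx C).
Proof. exact: closure_LU_tensor_mx. Qed.
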